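(* Let $N\ge 1$ and let $D$ be a signed diagram on the nodes $1,\dots,N-1$, with diagram demipotent $C_D=L_DR_D\in\mathbb{C}H_0(S_N)\subset\mathbb{C}H_0(S_{N+1})$. Let $D+$ (respectively $D-$) be the signed diagram on the nodes $1,\dots,N$ obtained by adjoining a node $N$ with sign $+$ (respectively $-$) at the end of $D$. Then in $\mathbb{C}H_0(S_{N+1})$ $$C_{D+}=L_D\,\pi_N\,R_D,\qquad C_{D-}=L_D\,\bar\pi_N\,R_D .$$ In particular $C_{D+}+C_{D-}=C_D$. Finally, the sum of the diagram demipotents $C_D$ over all signed diagrams $D$ on the nodes $1,\dots,N-1$ is the identity of $\mathbb{C}H_0(S_N)$.
   Context: The $0$-Hecke monoid $H_0(S_N)$ is generated by $\pi_1,\dots,\pi_{N-1}$ with relations $\pi_i^2=\pi_i$; $\pi_i\pi_j=\pi_j\pi_i$ for $|i-j|>1$; $\pi_i\pi_{i+1}\pi_i=\pi_{i+1}\pi_i\pi_{i+1}$. Its elements are indexed by permutations: $\sigma\in S_N$ corresponds to $\pi_{i_1}\cdots\pi_{i_k}$ for any reduced word $s_{i_1}\cdots s_{i_k}$ of $\sigma$. The $0$-Hecke algebra $\mathbb{C}H_0(S_N)$ is its monoid algebra over $\mathbb{C}$. $\mathbb{C}H_0(S_N)$ is identified with the subalgebra of $\mathbb{C}H_0(S_{N+1})$ generated by $\pi_1,\dots,\pi_{N-1}$. Put $\bar\pi_i=1-\pi_i$; the $\bar\pi_i$ satisfy the same relations, and $\Psi$ is the algebra automorphism with $\Psi(\pi_i)=\bar\pi_i$.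 For a set $J$ of indices of generators, $w_J^+$ is the longest element of the submonoid generated by $\{\pi_i : i\in J\}$, and $w_J^-=\Psi(w_J^+)$. A signed diagram $D$ on the nodes $1,\dots,n$ is an assignment of a sign $+$ or $-$ to each node $1,\dots,n$ (for $n=0$ the empty diagram). Let $P_1,\dots,P_m$ be the maximal intervals of consecutive nodes with the same sign, listed in increasing order, and let $sgn(k)$ be the common sign on $P_k$. Set $L_D=w_{P_1}^{sgn(1)}w_{P_2}^{sgn(2)}\cdots w_{P_m}^{sgn(m)}$ and $R_D=w_{P_m}^{sgn(m)}w_{P_{m-1}}^{sgn(m-1)}\cdots w_{P_1}^{sgn(1)}$ (both equal to $1$ for the empty diagram). The diagram demipotent is $C_D=L_DR_D$. *)

(* Defs.v *)
From HB Require Import structures.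
From mathcomp Require Import all_boot all_order all_algebra.
From mathcomp Require Import boolp classical_sets reals.
From mathcomp Require Import complex monalg.

Set Implicit Arguments.
Unset Strict Implicit.
Unset Printing Implicit Defensive.

Import GRing.Theory.
Local Open Scope ring_scope.
Local Open Scope quotient_scope.

(* Indexing: [n] is the number of generators, so that [hecke n] is the monoid *)
(* H_0(S_(n+1)) and [i : 'I_n] stands for the generator pi_(i+1), resp. for   *)
(* the node i+1 of a diagram.                                                 *)

Inductive hecke_rule (n : nat) : seq 'I_n -> seq 'I_n -> Prop :=
| HeckeIdem (i : 'I_n) : hecke_rule [:: i; i] [:: i]
| HeckeComm (i j : 'I_n) : (i.+1 < j)%N || (j.+1 < i)%N ->
    hecke_rule [:: i; j] [:: j; i]
| HeckeBraid (i j : 'I_n) : j = i.+1 :> nat ->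
    hecke_rule [:: i; j; i] [:: j; i; j].

Inductive hecke_eq (n : nat) : seq 'I_n -> seq 'I_n -> Prop :=
| HeckeStep (s t u v : seq 'I_n) : hecke_rule u v ->
    hecke_eq (s ++ u ++ t) (s ++ v ++ t)
| HeckeRefl (u : seq 'I_n) : hecke_eq u u
| HeckeSym (u v : seq 'I_n) : hecke_eq u v -> hecke_eq v u
| HeckeTrans (u v w : seq 'I_n) :
    hecke_eq u v -> hecke_eq v w -> hecke_eq u w.

Definition hecke_eqb (n : nat) : rel (seq 'I_n) :=
  fun u v => `[< hecke_eq u v >].

Lemma hecke_eqb_refl (n : nat) : reflexive (@hecke_eqb n).
Proof. by move=> u; apply/asboolP; exact: HeckeRefl. Qed.

Lemma hecke_eqb_sym (n : nat) : symmetric (@hecke_eqb n).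
Proof. by move=> u v; apply/asboolP/asboolP; exact: HeckeSym. Qed.

Lemma hecke_eqb_trans (n : nat) : transitive (@hecke_eqb n).
Proof.
move=> v u w /asboolP uv /asboolP vw; apply/asboolP; exact: (HeckeTrans uv vw).
Qed.

Canonical hecke_equiv (n : nat) : equiv_rel (seq 'I_n) :=
  EquivRel (@hecke_eqb n)
    (@hecke_eqb_refl n) (@hecke_eqb_sym n) (@hecke_eqb_trans n).

Definition hecke (n : nat) : Type := {eq_quot (hecke_equiv n)}.
HB.instance Definition _ (n : nat) := Choice.on (hecke n).
HB.instance Definition _ (n : nat) :=
  Quotient.copy (hecke n) {eq_quot (hecke_equiv n)}.

Definition hword (n : nat) (u : seq 'I_n) : hecke n := \pi_(hecke n) u.

Lemma hwordP (n : nat) (u v : seq 'I_n) : hword u = hword v <-> hecke_eq u v.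
Proof.
split=> [/eqmodP /asboolP //|uv]; apply/eqmodP; exact/asboolP.
Qed.

Lemma hword_repr (n : nat) (x : hecke n) : hword (repr x) = x.
Proof. exact: reprK. Qed.

Lemma hecke_eq_cat (n : nat) (u u' v v' : seq 'I_n) :
  hecke_eq u u' -> hecke_eq v v' -> hecke_eq (u ++ v) (u' ++ v').
Proof.
have catr (w w' t : seq 'I_n) : hecke_eq w w' -> hecke_eq (w ++ t) (w' ++ t).
  elim=> {w w'} [s t' a b ab|a|a b _|a b c _ IH1 _ IH2].
  - by rewrite -!catA; exact: HeckeStep.
  - exact: HeckeRefl.
  - exact: HeckeSym.
  - exact: (HeckeTrans IH1 IH2).
have catl (w w' t : seq 'I_n) : hecke_eq w w' -> hecke_eq (t ++ w) (t ++ w').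
  elim=> {w w'} [s t' a b ab|a|a b _|a b c _ IH1 _ IH2].
  - by rewrite !(catA t); exact: HeckeStep.
  - exact: HeckeRefl.
  - exact: HeckeSym.
  - exact: (HeckeTrans IH1 IH2).
by move=> uu vv; exact: (HeckeTrans (catr _ _ _ uu) (catl _ _ _ vv)).
Qed.

Definition hone (n : nat) : hecke n := hword [::].
Definition hmul (n : nat) (x y : hecke n) : hecke n :=
  hword (repr x ++ repr y).

Lemma hmulE (n : nat) (u v : seq 'I_n) :
  hmul (hword u) (hword v) = hword (u ++ v).
Proof. by apply/hwordP/hecke_eq_cat; apply/hwordP; exact: hword_repr. Qed.

Lemma hmulA (n : nat) : associative (@hmul n).
Proof.
move=> x y z; rewrite -(hword_repr x) -(hword_repr y) -(hword_repr z).
by rewrite !hmulE catA.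
Qed.

Lemma hmul1 (n : nat) : left_id (hone n) (@hmul n).
Proof. by move=> x; rewrite -(hword_repr x) hmulE. Qed.

Lemma hmulr1 (n : nat) : right_id (hone n) (@hmul n).
Proof. by move=> x; rewrite -(hword_repr x) hmulE cats0. Qed.

Lemma hecke_eq_nil (n : nat) (u v : seq 'I_n) :
  hecke_eq u v -> (u == [::]) = (v == [::]).
Proof.
elim=> [s t a b|//|a b _ ->|a b c _ -> _ ->] //.
by case: s => //; case.
Qed.

Lemma hunit (n : nat) (x y : hecke n) :
  hmul x y = hone n -> x = hone n /\ y = hone n.
Proof.
rewrite -(hword_repr x) -(hword_repr y) hmulE => /hwordP /hecke_eq_nil.
by rewrite eqxx; case: (repr x) => //=; case: (repr y).
Qed.

HB.instance Definition _ (n : nat) :=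
  Choice_isMonomialDef.Build (hecke n)
    (@hmulA n) (@hmul1 n) (@hmulr1 n) (@hunit n).

(* [hlength x] is the least length of a word for [x], i.e. the length of the  *)
(* reduced words of the permutation indexing [x].                             *)
Lemma hlength_ex (n : nat) (x : hecke n) :
  exists k, `[< exists2 u : seq 'I_n, size u = k & hword u = x >].
Proof.
by exists (size (repr x)); apply/asboolP; exists (repr x); rewrite ?hword_repr.
Qed.

Definition hlength (n : nat) (x : hecke n) : nat := ex_minn (hlength_ex x).

Definition in_submonoid (n : nat) (J : {set 'I_n}) (x : hecke n) : Prop :=
  exists2 u : seq 'I_n, {subset u <= J} & x = hword u.

Definition longest_in (n : nat) (J : {set 'I_n}) (w : hecke n) : Prop :=
  in_submonoid J w /\ forall v, in_submonoid J v -> (hlength v <= hlength w)%N.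

(* [xget] returns an element of the set whenever there is one; the longest    *)
(* element exists and is unique since H_0(S_J) is indexed by a finite Coxeter *)
(* group.                                                                     *)
Definition longest (n : nat) (J : {set 'I_n}) : hecke n :=
  xget (hone n) [set w | longest_in J w]%classic.

Definition hecke_alg (R : realType) (n : nat) : Type := {malg R[i][hecke n]}.
HB.instance Definition _ (R : realType) (n : nat) :=
  GRing.Lalgebra.on (hecke_alg R n).

Lemma hecke_alg_scalerAr (R : realType) (n : nat) (c : R[i])
    (x y : hecke_alg R n) : c *: (x * y) = x * (c *: y).
Proof.
have comm z : c%:MP * z = z * c%:MP :> {malg R[i][hecke n]}.
  rewrite mul_malgC malgZ_def [RHS]fgmulgU.
  by apply: eq_bigr => k _; rewrite mulm1 mulrC.
by rewrite -[LHS]mul_malgC -[in RHS]mul_malgC mulrA comm -mulrA.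
Qed.
HB.instance Definition _ (R : realType) (n : nat) :=
  GRing.Lalgebra_isAlgebra.Build R[i] (hecke_alg R n)
    (@hecke_alg_scalerAr R n).

Definition hpi (R : realType) (n : nat) (i : 'I_n) : hecke_alg R n :=
  << hword [:: i] >>.

Definition hpibar (R : realType) (n : nat) (i : 'I_n) : hecke_alg R n :=
  1 - hpi R i.

Record hecke_family (n : nat) (A : nzRingType) (f : 'I_n -> A) : Prop := {
  hecke_family_idem : forall i, f i * f i = f i;
  hecke_family_comm : forall i j : 'I_n, (i.+1 < j)%N || (j.+1 < i)%N ->
    f i * f j = f j * f i;
  hecke_family_braid : forall i j : 'I_n, j = i.+1 :> nat ->
    f i * f j * f i = f j * f i * f j }.

Lemma hecke_family_prod (n : nat) (A : nzRingType) (f : 'I_n -> A) :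
  hecke_family f -> forall u v, hecke_eq u v ->
  \prod_(i <- u) f i = \prod_(i <- v) f i.
Proof.
case=> fI fC fB u v; elim=> {u v} [s t u v uv|//|u v _ -> //|u v w _ -> _ -> //].
rewrite !big_cat /=; congr (_ * (_ * _)).
case: uv => [i|i j ij|i j ij]; rewrite !big_cons !big_nil ?mulr1 //.
- exact: fC.
- by rewrite !mulrA fB.
Qed.

(* The linear map sending the element of a word i_1 ... i_k to                *)
(* f i_1 * ... * f i_k; it is an algebra morphism when [f] satisfies the      *)
(* defining relations.                                                        *)
Definition hlift (R : realType) (n : nat) (A : algType R[i]) (f : 'I_n -> A)
    (x : hecke_alg R n) : A :=
  mmap (in_alg A) (fun g : hecke n => \prod_(i <- repr g) f i) x.

Section HeckeLift.
Variables (R : realType) (n : nat) (A : algType R[i]) (f : 'I_n -> A).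
Hypothesis hf : hecke_family f.

Let h (g : hecke n) : A := \prod_(i <- repr g) f i.

Lemma hlift_word (u : seq 'I_n) : h (hword u) = \prod_(i <- u) f i.
Proof. by apply/(hecke_family_prod hf)/hwordP/hword_repr. Qed.

Fact hlift_mmorphism : mmorphism h.
Proof.
split=> [x y|]; last by rewrite hlift_word big_nil.
rewrite -(hword_repr x) -(hword_repr y).
by rewrite [X in h X]hmulE !hlift_word big_cat.
Qed.

Let hM : {mmorphism hecke n -> A} :=
  HB.pack_for (MMorphism.type (hecke n) A) h
    (isMultiplicative.Build _ _ h hlift_mmorphism).

Lemma hlift_additive : {morph hlift f : x y / x - y}.
Proof. exact: mmapB. Qed.

Lemma hlift_scalable c x : hlift f (c *: x) = c *: hlift f x.
Proof. by rewrite [LHS](@mmapZ _ _ _ (in_alg A) hM) mulr_algl. Qed.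

Lemma hlift_monoid : (hlift f 1 = 1) * {morph hlift f : x y / x * y}.
Proof.
have [fM f1] : {morph hlift f : x y / x * y} * (hlift f 1 = 1).
  apply: (@commr_mmap_is_multiplicative (hecke n) _ _ (in_alg A) hM).
  by move=> g k k'; rewrite /GRing.comm /= mulr_algl mulr_algr.
by split.
Qed.

Lemma hlift_gen i : hlift f (hpi R i) = f i.
Proof.
rewrite [LHS](@mmapU _ _ _ (in_alg A)) /= scale1r mul1r.
by rewrite [LHS]hlift_word big_seq1.
Qed.

End HeckeLift.

Lemma hpi_prod (R : realType) (n : nat) (u : seq 'I_n) :
  \prod_(i <- u) hpi R i = << hword u >>.
Proof.
elim: u => [|i u IHu]; rewrite ?big_nil ?big_cons // IHu.
by rewrite /hpi [LHS]fgmulUU mulr1 [mmul _ _]hmulE.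
Qed.

Lemma hecke_alg_ext (R : realType) (n : nat) (A : algType R[i])
    (F G : {lrmorphism hecke_alg R n -> A}) :
  (forall i, F (hpi R i) = G (hpi R i)) -> F =1 G.
Proof.
move=> FG x.
have -> : x = \sum_(g <- finmap.enum_fset (msupp x)) x@_g *: \prod_(i <- repr g) hpi R i.
  rewrite [LHS]monalgE; apply: eq_bigr => g _; rewrite hpi_prod hword_repr.
  by apply/malgP => k; rewrite mcoeffZ !mcoeffU mulr_natr.
rewrite !linear_sum; apply: eq_bigr => g _; rewrite [LHS]linearZ [RHS]linearZ /=.
congr (_ *: _); rewrite !rmorph_prod; apply: eq_bigr => i _; exact: FG.
Qed.

Lemma hecke_family_pi (R : realType) (n : nat) : hecke_family (@hpi R n).
Proof.
have E (u v : seq 'I_n) : hecke_rule u v ->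
    \prod_(i <- u) hpi R i = \prod_(i <- v) hpi R i.
  move=> uv; rewrite !hpi_prod; congr mkmalgU; apply/hwordP.
  by have := HeckeStep [::] [::] uv; rewrite !cats0.
split=> [i|i j ij|i j ij].
- by have := E _ _ (HeckeIdem i); rewrite !big_cons !big_nil !mulr1.
- by have := E _ _ (HeckeComm ij); rewrite !big_cons !big_nil !mulr1.
- by have := E _ _ (HeckeBraid ij); rewrite !big_cons !big_nil !mulr1 !mulrA.
Qed.

Lemma hecke_family_compl (n : nat) (A : nzRingType) (f : 'I_n -> A) :
  hecke_family f -> hecke_family (fun i => 1 - f i).
Proof.
case=> fI fC fB.
split=> [i|i j ij|i j ij].
- by rewrite mulrBl mul1r mulrBr mulr1 fI subrr subr0.
- rewrite !mulrBl !mul1r !mulrBr !mulr1 fC // !opprB !addrA.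
  rewrite [LHS]addrAC [RHS]addrAC; congr (_ + _); exact: addrAC.
- have expand (a b : A) : a * a = a ->
    (1 - a) * (1 - b) * (1 - a) = 1 - a - b + (a * b + b * a) - a * b * a.
    move=> aa; rewrite !mulrBr !mulr1 !mulrBl !mul1r aa subrr sub0r opprK.
    by rewrite opprB !addrA (addrAC (1 - a)).
  by rewrite !expand // (fB _ _ ij) (addrAC 1) (addrC (f i * _)).
Qed.

Lemma hecke_family_pibar (R : realType) (n : nat) :
  hecke_family (@hpibar R n).
Proof. exact/hecke_family_compl/hecke_family_pi. Qed.

Definition Psi (R : realType) (n : nat) : hecke_alg R n -> hecke_alg R n :=
  hlift (@hpibar R n).

Section PsiMorphism.
Variables (R : realType) (n : nat).

HB.instance Definition _ := GRing.isZmodMorphism.Build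
  (hecke_alg R n) (hecke_alg R n) (@Psi R n)
  (hlift_additive (@hpibar R n)).
HB.instance Definition _ := GRing.isMonoidMorphism.Build
  (hecke_alg R n) (hecke_alg R n) (@Psi R n)
  (hlift_monoid (@hecke_family_pibar R n)).
HB.instance Definition _ := GRing.isScalable.Build
  R[i] (hecke_alg R n) (hecke_alg R n) *:%R (@Psi R n)
  (hlift_scalable (@hecke_family_pibar R n)).

Lemma Psi_pi i : Psi (hpi R i) = hpibar R i :> hecke_alg R n.
Proof. exact/hlift_gen/hecke_family_pibar. Qed.

Lemma Psi_involutive : involutive (@Psi R n).
Proof.
move=> x; apply: (@hecke_alg_ext R n _ (@Psi R n \o @Psi R n) idfun) => i /=.
transitivity (Psi (1 - hpi R i : hecke_alg R n)).
  by congr Psi; exact: Psi_pi.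
rewrite rmorphB rmorph1.
transitivity (1 - hpibar R i : hecke_alg R n); last exact: subKr.
by congr (1 - _); exact: Psi_pi.
Qed.

End PsiMorphism.

(* The identification of C H_0(S_(n+1)) with the subalgebra of C H_0(S_(n+2)) *)
(* generated by all generators but the last.                                  *)
Definition hincl (R : realType) (n : nat) :
    hecke_alg R n -> hecke_alg R n.+1 :=
  hlift (fun i : 'I_n => hpi R (widen_ord (leqnSn n) i)).

Lemma hecke_family_widen (n : nat) (A : nzRingType) (f : 'I_n.+1 -> A) :
  hecke_family f ->
  hecke_family (fun i : 'I_n => f (widen_ord (leqnSn n) i)).
Proof.
by case=> fI fC fB; split=> [i|i j ij|i j ij]; [exact: fI|exact: fC|exact: fB].
Qed.

Lemma hecke_family_incl (R : realType) (n : nat) :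
  hecke_family (fun i : 'I_n => hpi R (widen_ord (leqnSn n) i)).
Proof. exact/hecke_family_widen/hecke_family_pi. Qed.

Section InclMorphism.
Variables (R : realType) (n : nat).

HB.instance Definition _ := GRing.isZmodMorphism.Build
  (hecke_alg R n) (hecke_alg R n.+1) (@hincl R n)
  (hlift_additive (fun i : 'I_n => hpi R (widen_ord (leqnSn n) i))).
HB.instance Definition _ := GRing.isMonoidMorphism.Build
  (hecke_alg R n) (hecke_alg R n.+1) (@hincl R n)
  (hlift_monoid (@hecke_family_incl R n)).
HB.instance Definition _ := GRing.isScalable.Build
  R[i] (hecke_alg R n) (hecke_alg R n.+1) *:%R (@hincl R n)
  (hlift_scalable (@hecke_family_incl R n)).

Lemma hincl_pi i : hincl (hpi R i) = hpi R (widen_ord (leqnSn n) i).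
Proof. exact/hlift_gen/hecke_family_incl. Qed.

End InclMorphism.

(* Sending the last generator to 1 respects the relations and retracts hincl. *)
Definition kill_last (n : nat) (A : nzRingType) (f : 'I_n -> A)
    (i : 'I_n.+1) : A :=
  if unlift ord_max i is Some j then f j else 1.

Lemma hecke_family_kill_last (n : nat) (A : nzRingType) (f : 'I_n -> A) :
  hecke_family f -> hecke_family (kill_last f).
Proof.
have lift_val (j : 'I_n) : lift ord_max j = j :> nat.
  by rewrite /= /bump leqNgt ltn_ord.
case=> fI fC fB; rewrite /kill_last; split=> [i|i j|i j].
- by case: unliftP => [k _|_]; rewrite ?fI ?mulr1.
- case: unliftP => [k ->|_]; case: unliftP => [l ->|_];
    rewrite ?mul1r ?mulr1 //.
  by rewrite !lift_val; exact: fC.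
- case: unliftP => [k ->|->]; case: unliftP => [l ->|->];
    rewrite ?mul1r ?mulr1 ?fI //.
  by rewrite !lift_val; exact: fB.
Qed.

Section InclInjective.
Variables (R : realType) (n : nat).

Let hr := hecke_family_kill_last (hecke_family_pi R n).

Let retract : hecke_alg R n.+1 -> hecke_alg R n := hlift (kill_last (@hpi R n)).

HB.instance Definition _ := GRing.isZmodMorphism.Build
  (hecke_alg R n.+1) (hecke_alg R n) retract (hlift_additive (kill_last (@hpi R n))).
HB.instance Definition _ := GRing.isMonoidMorphism.Build
  (hecke_alg R n.+1) (hecke_alg R n) retract (hlift_monoid hr).
HB.instance Definition _ := GRing.isScalable.Build
  R[i] (hecke_alg R n.+1) (hecke_alg R n) *:%R retract
  (hlift_scalable hr).

Lemma hincl_inj : injective (@hincl R n).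
Proof.
apply: (can_inj (g := retract)) => x.
apply: (@hecke_alg_ext R n _ (retract \o @hincl R n) idfun) => i.
transitivity (retract (hpi R (widen_ord (leqnSn n) i))).
  by congr retract; exact: hincl_pi.
rewrite [LHS](hlift_gen hr) /kill_last.
have -> : widen_ord (leqnSn n) i = lift ord_max i.
  by apply: val_inj; rewrite /= /bump leqNgt ltn_ord.
by rewrite liftK.
Qed.

End InclInjective.

(* A signed diagram on n nodes is an [n.-tuple bool], [true] being the sign + *)
(* and [false] the sign -.                                                    *)

Definition interval (n : nat) (J : {set 'I_n}) : bool :=
  [forall i in J, forall k in J, forall j : 'I_n,
    (i <= j <= k)%N ==> (j \in J)].

Definition same_sign (n : nat) (D : n.-tuple bool) (J : {set 'I_n}) : bool :=
  [forall i in J, forall j in J, tnth D i == tnth D j].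

Definition is_block (n : nat) (D : n.-tuple bool) (J : {set 'I_n}) : bool :=
  maxset (fun K => [&& K != finset.set0, interval K & same_sign D K]) J.

(* On nonempty sets: the least element of [J] is at most that of [K]. *)
Definition starts_before (n : nat) : rel {set 'I_n} :=
  fun J K => [exists i in J, forall j in K, (i <= j)%N].

(* P_1, ..., P_m in increasing order. *)
Definition blocks (n : nat) (D : n.-tuple bool) : seq {set 'I_n} :=
  sort (@starts_before n) (enum (is_block D)).

Definition block_sign (n : nat) (D : n.-tuple bool) (J : {set 'I_n}) : bool :=
  [exists i in J, tnth D i].

Definition w_signed (R : realType) (n : nat) (s : bool) (J : {set 'I_n}) :
    hecke_alg R n :=
  if s then << longest J >> else Psi << longest J >>.

Definition L_diag (R : realType) (n : nat) (D : n.-tuple bool) :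
    hecke_alg R n :=
  \prod_(P <- blocks D) w_signed R (block_sign D P) P.

Definition R_diag (R : realType) (n : nat) (D : n.-tuple bool) :
    hecke_alg R n :=
  \prod_(P <- rev (blocks D)) w_signed R (block_sign D P) P.

Definition C_diag (R : realType) (n : nat) (D : n.-tuple bool) :
    hecke_alg R n :=
  L_diag R D * R_diag R D.

(* Main.v *)
Require Import Defs.
From HB Require Import structures.
From mathcomp Require Import all_boot all_order all_algebra.
From mathcomp Require Import boolp classical_sets reals.
From mathcomp Require Import complex monalg.
From mathcomp Require Import zify.

Set Implicit Arguments.
Unset Strict Implicit.
Unset Printing Implicit Defensive.

Import GRing.Theory.
Local Open Scope ring_scope.

(* Let P be the last block of D if the new sign extends it, and P empty       *)
(* otherwise. In both cases the new last block has longest element            *)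
(* w' = w_P pi_N w_P (with the sign of the new node), L_D = X w_P and         *)
(* R_D = w_P Y where X and Y come from the other blocks, and w' is            *)
(* idempotent, so that                                                        *)
(* C_(D+) = X w' w' Y = (X w_P) pi_N (w_P Y) = L_D pi_N R_D.                  *)
(* Adding the two signs and inducting on N gives the sum over all D.          *)
(*                                                                            *)
(* To compute the longest element of the submonoid on J, it is enough to find *)
(* an element that absorbs the generators of J on the left, provided that     *)
(* right multiplication by a generator either fixes an element or lengthens   *)
(* it by one. The latter is read off a normal form: each element is a product *)
(* of descending runs pi_(m-1) ... pi_(m-r), one for each m <= n, so that it  *)
(* is coded by the list of the r's.                                           *)

(** * Codes of the elements of the 0-Hecke monoid *)

(** The recursion [C_diag_rcons] rests on two facts. The first is a formula for longest elements:
    the word [top_word s] obeys top(s i) = top(s) i top(s), which is the identity w' = w_P pi_N w_P.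
    [top_word_absorb] derives from the defining relations alone that its product absorbs every
    generator in [s], so one formula serves both the pi_i and their complements ([w_signedE]).
    [longest_eq] turns absorption into being the longest element, by means of the length dichotomy
    [hmul_gen]. The second fact is combinatorial: adjoining a node affects at most the last block
    ([blocks_rcons], [blocks_last_part]). The middle factors pi_N and 1 - pi_N add up to 1, which
    gives the sum over all diagrams by induction. *)

Section Codes.
Local Open Scope nat_scope.

(* A code is a list of run lengths, the longest level first: the run of       *)
(* length [r] at the head of [r :: c] is m, m-1, ..., run_start m r, where    *)
(* m = size c, and [act c i] is the code of the right multiple by [i].        *)
Definition run_start (m r : nat) : nat := m.+1 - r.

Fixpoint act (c : seq nat) (i : nat) : seq nat :=
  if c isn't r :: c' then [::] else
  let k := run_start (size c') r in
  if i.+1 < k then r :: act c' i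
  else if i.+1 == k then r.+1 :: c'
  else if i == k then c
  else r :: act c' i.-1.

Lemma size_act c i : size (act c i) = size c.
Proof.
by elim: c i => //= r c IH i; do 3?case: ifP => _ //=; rewrite IH.
Qed.

Lemma act_below r c i :
  i.+1 < run_start (size c) r -> act (r :: c) i = r :: act c i.
Proof. by move=> /= ->. Qed.

Lemma act_extend r c i :
  i.+1 = run_start (size c) r -> act (r :: c) i = r.+1 :: c.
Proof. by move=> /= <-; rewrite ltnn eqxx. Qed.

Lemma act_fix r c i : i = run_start (size c) r -> act (r :: c) i = r :: c.
Proof. by move=> /= <-; rewrite ltnNge leqnSn gtn_eqF ?ltnSn ?eqxx. Qed.

Lemma act_above r c i :
  run_start (size c) r < i -> act (r :: c) i = r :: act c i.-1.
Proof.
move=> ki /=; rewrite ltnNge (leq_trans (ltnW ki)) ?leqnSn //=.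
by rewrite !gtn_eqF // ltnS ltnW.
Qed.

Lemma run_startS m r i : i.+1 = run_start m r -> run_start m r.+1 = i.
Proof. by rewrite /run_start subnS => <-. Qed.

(** The four ways a generator meets the run on its left: it commutes with the whole run, lengthens
    it, is absorbed by its last letter, or passes through it and comes out as i - 1
    ([drun_above]). *)
Variant act_spec r c i : seq nat -> Prop :=
| ActBelow of i.+1 < run_start (size c) r : act_spec r c i (r :: act c i)
| ActExtend of i.+1 = run_start (size c) r : act_spec r c i (r.+1 :: c)
| ActFix of i = run_start (size c) r : act_spec r c i (r :: c)
| ActAbove of run_start (size c) r < i : act_spec r c i (r :: act c i.-1).

Lemma actP r c i : act_spec r c i (act (r :: c) i).
Proof.
case: (ltngtP i (run_start (size c) r)) => [|ki|ki].
- rewrite leq_eqVlt => /predU1P[ik|ik].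
    by rewrite act_extend //; constructor.
  by rewrite act_below //; constructor.
- by rewrite act_above //; constructor.
- by rewrite act_fix //; constructor.
Qed.

Lemma sumn_act c i : act c i = c \/ sumn (act c i) = (sumn c).+1.
Proof.
elim: c i => [|r c IH] i; first by left.
case: actP => _ /=; [|by right|by left|].
  by have [->|->] := IH i; [left|right; rewrite addnS].
by have [->|->] := IH i.-1; [left|right; rewrite addnS].
Qed.

(** With [act_comm] and [act_braid], this checks the defining relations on codes, so that the monoid
    acts on codes from the right ([foldl_act_hecke_eq]). *)
Lemma act_idem c i : act (act c i) i = act c i.
Proof.
elim: c i => // r c IH i.
case: actP => ik; first by rewrite act_below ?size_act // IH.
- by rewrite act_fix ?(run_startS ik).
- by rewrite act_fix.
- by rewrite act_above ?size_act // IH.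
Qed.

Lemma act_comm c i j : i.+1 < j -> act (act c i) j = act (act c j) i.
Proof.
elim: c i j => // r c IH i j ij.
case: (actP r c j) => jk.
- have ik : i.+1 < run_start (size c) r by lia.
  by rewrite (act_below ik) act_below ?size_act // act_below ?size_act // IH.
- have ik : i.+1 < run_start (size c) r by lia.
  rewrite (act_below ik) act_extend ?size_act //.
  by rewrite act_below ?(run_startS jk).
- have ik : i.+1 < run_start (size c) r by lia.
  by rewrite (act_below ik) act_fix ?size_act.
case: (actP r c i) => ik.
- rewrite act_above ?size_act // act_below ?size_act //; congr (_ :: _).
  by apply: IH; lia.
- by rewrite act_above ?act_extend ?size_act // (run_startS ik); lia.
- by rewrite act_above // act_fix ?size_act.
- rewrite act_above ?size_act // act_above ?size_act //; congr (_ :: _).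
  by apply: IH; lia.
Qed.

Lemma act_braid c i :
  act (act (act c i) i.+1) i = act (act (act c i.+1) i) i.+1.
Proof.
elim: c i => // r c IH i.
case: (actP r c i) => ik.
- case: (actP r c i.+1) => ik'; [ | | lia | lia].
  + rewrite act_below ?size_act // act_below ?size_act //.
    by rewrite act_below ?size_act // act_below ?size_act // IH.
  + have k1 := run_startS ik'; have k2 := run_startS (esym k1).
    rewrite act_extend ?size_act // act_extend ?size_act //.
    by rewrite act_extend // act_above ?k2.
- have k1 := run_startS ik.
  by rewrite (act_fix ik) (act_extend ik) act_above ?k1 // act_fix ?size_act.
- have ik1 : run_start (size c) r < i.+1 by rewrite -ik.
  rewrite act_above // act_fix ?size_act // act_above ?size_act //.
  by rewrite act_idem.
- have ik1 : run_start (size c) r < i.+1 by lia.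
  do 5![rewrite act_above ?size_act //].
  (* Here i exceeds the start of the run, so it is positive, and the letters passed on to [c],
     namely i - 1 and i, are again consecutive. *)
  by case: i ik {ik1} => // i _; congr (_ :: _); apply: IH.
Qed.

End Codes.

Local Notation wid := (widen_ord (leqnSn _)).

(** * Normal form and length in the 0-Hecke monoid *)

Section Hecke.
Variable n : nat.
Implicit Types (x y : hecke n) (c : seq nat).

Local Notation "x ** y" := (hmul x y) (at level 40, left associativity).

(* Letters that are not generators are dropped: [gen i = 1] for [n <= i]. *)
Definition nword (s : seq nat) : hecke n := hword (pmap insub s).

Local Notation gen i := (nword [:: i]).

Lemma nword_cat s t : nword (s ++ t) = nword s ** nword t.
Proof. by rewrite /nword pmap_cat hmulE. Qed.

Lemma nword_val (u : seq 'I_n) : nword (map val u) = hword u.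
Proof. by rewrite /nword map_pK //; exact: valK. Qed.

Lemma gen_lt i (ni : (i < n)%N) : gen i = hword [:: Ordinal ni].
Proof. exact: (nword_val [:: Ordinal ni]). Qed.

Lemma gen_ge i : (n <= i)%N -> gen i = hone n.
Proof. by move=> ni; rewrite /nword /= insubF // ltnNge ni. Qed.

Lemma hword_rule (u v : seq 'I_n) : hecke_rule u v -> hword u = hword v.
Proof.
by move=> uv; apply/hwordP; have := HeckeStep [::] [::] uv; rewrite !cats0.
Qed.

Lemma gen_idem i : gen i ** gen i = gen i.
Proof.
have [ni|ni] := leqP n i; first by rewrite !gen_ge // hmul1.
by rewrite !gen_lt hmulE; exact/hword_rule/HeckeIdem.
Qed.

Lemma gen_comm i j : (i.+1 < j)%N -> gen i ** gen j = gen j ** gen i.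
Proof.
move=> ij; have [nj|nj] := leqP n j; first by rewrite (gen_ge nj) hmul1 hmulr1.
have ni : (i < n)%N by rewrite (leq_trans _ nj) // ltnS ltnW // ltnW.
rewrite !gen_lt !hmulE.
by apply/hword_rule/HeckeComm; rewrite /= ij.
Qed.

Lemma gen_braid i :
  gen i ** gen i.+1 ** gen i = gen i.+1 ** gen i ** gen i.+1.
Proof.
have [nj|nj] := leqP n i.+1.
  by rewrite (gen_ge nj) !hmul1 !hmulr1 gen_idem.
have ni := ltnW nj.
by rewrite !gen_lt !hmulE; exact/hword_rule/HeckeBraid.
Qed.

Definition drun (k m : nat) : seq nat := rev (iota k (m - k)).

Fixpoint cword c : seq nat :=
  if c isn't r :: c' then [::]
  else cword c' ++ drun (run_start (size c') r) (size c').+1.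

Lemma size_cword c : (size (cword c) <= sumn c)%N.
Proof.
elim: c => //= r c IH; rewrite size_cat addnC leq_add // size_rev size_iota.
by rewrite /run_start leq_subCl.
Qed.

Lemma drun_cons k m : (k <= m)%N -> drun k m.+1 = m :: drun k m.
Proof. by move=> km; rewrite /drun subSn // -addn1 iotaD rev_cat /= subnKC. Qed.

Lemma drun_rcons k m : (k < m)%N -> drun k m = rcons (drun k.+1 m) k.
Proof. by move=> km; rewrite /drun -subnSK //= rev_cons. Qed.

Lemma drun_cat i k m : (k <= i <= m)%N -> drun k m = drun i m ++ drun k i.
Proof.
case/andP=> ki im; rewrite /drun -rev_cat; congr rev.
by rewrite -[X in iota X (m - i)](subnKC ki) -iotaD addnC addnBA // subnK.
Qed.

Lemma nword_comm (s : seq nat) i :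
    all (fun j => (i.+1 < j) || (j.+1 < i))%N s ->
  nword s ** gen i = gen i ** nword s.
Proof.
elim: s => [_|j s IH /= /andP[ij /IH {}IH]]; first by rewrite hmul1 hmulr1.
rewrite -cat1s nword_cat -hmulA IH !hmulA.
by case/orP: ij => ij; rewrite (gen_comm ij).
Qed.

Lemma drun_comm k m i : (i.+1 < k)%N || (m < i)%N ->
  nword (drun k m) ** gen i = gen i ** nword (drun k m).
Proof.
move=> ikm; apply: nword_comm; apply/allP => j; rewrite mem_rev mem_iota.
by move: ikm; lia.
Qed.

(** The letter i commutes with the tail of the run below i - 1, one braid move turns i (i-1) i into
    (i-1) i (i-1), and the new leading i - 1 commutes with the part of the run above i. *)
Lemma drun_above k m i : (k < i < m)%N ->
  nword (drun k m) ** gen i = gen i.-1 ** nword (drun k m).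
Proof.
case: i => // i /andP[ki im]; rewrite ltnS in ki.
have dE : drun k m = drun i.+2 m ++ [:: i.+1] ++ [:: i] ++ drun k i.
  rewrite (@drun_cat i.+2) ?im ?(leq_trans ki) ?leqW //; congr (_ ++ _).
  by rewrite !drun_cons ?leqW.
have braid x : gen i.+1 ** (gen i ** (gen i.+1 ** x)) =
    gen i ** (gen i.+1 ** (gen i ** x)) by rewrite !hmulA gen_braid.
rewrite dE !nword_cat -!hmulA (drun_comm (k := k)) ?ltnSn ?orbT // braid.
by rewrite hmulA drun_comm ?ltnSn // -!hmulA.
Qed.

Lemma nword_cword_act c i : (i < size c)%N ->
  nword (cword (act c i)) = nword (cword c) ** gen i.
Proof.
elim: c i => // r c IH i; rewrite [size _]/= ltnS => ic.
case: actP => ik /=; rewrite !nword_cat ?size_act -?hmulA.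
- by rewrite drun_comm ?ik // IH -?hmulA //; move: ik; rewrite /run_start; lia.
- have im : (i < (size c).+1)%N by move: ik; rewrite /run_start; lia.
  by rewrite (run_startS ik) -ik (drun_rcons im) -cats1 nword_cat.
- by rewrite -ik drun_rcons ?ltnS // -cats1 nword_cat -!hmulA gen_idem.
- by rewrite drun_above ?ik ?ltnS // IH -?hmulA //; lia.
Qed.

Lemma foldl_act_hecke_eq (u v : seq 'I_n) : hecke_eq u v ->
  forall c, foldl act c (map val u) = foldl act c (map val v).
Proof.
elim=> {u v} [s t u v uv|//|u v _ IH|u v w _ IH1 _ IH2] c; last 2 first.
- by rewrite IH.
- by rewrite IH1.
rewrite !map_cat !foldl_cat; congr foldl.
move: (foldl act c (map val s)) => {}c.
case: uv => [i|i j /orP[] ij|i j /= ->] /=.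
- exact: act_idem.
- exact: act_comm.
- exact/esym/act_comm.
- exact: act_braid.
Qed.

(** The orbit map of the action at the code of the identity, all of whose runs are empty. It is
    injective, since [cword] recovers the element ([hcodeK]). *)
Definition hcode x : seq nat := foldl act (nseq n 0%N) (map val (repr x)).

Lemma hcode_word (u : seq 'I_n) :
  hcode (hword u) = foldl act (nseq n 0%N) (map val u).
Proof. by apply/foldl_act_hecke_eq/hwordP/hword_repr. Qed.

Lemma size_hcode x : size (hcode x) = n.
Proof.
rewrite /hcode; elim/last_ind: (map val _) => [|s i IH]; first exact: size_nseq.
by rewrite foldl_rcons size_act.
Qed.

Lemma hcode_gen x (i : 'I_n) : hcode (hmul x (hword [:: i])) = act (hcode x) i.
Proof.
by rewrite -(hword_repr x) hmulE !hcode_word map_cat foldl_cat.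
Qed.

Lemma hcodeK x : nword (cword (hcode x)) = x.
Proof.
rewrite -{2}(hword_repr x) /hcode; elim/last_ind: (repr x) => [|u i IH].
  rewrite (size0nil (s := cword _)) //; apply/eqP.
  by rewrite -leqn0 (leq_trans (size_cword _)) // sumn_nseq.
rewrite map_rcons foldl_rcons nword_cword_act.
  by rewrite IH -cats1 -hmulE -(nword_val [:: i]).
by have := size_hcode (hword u); rewrite hcode_word => ->; exact: ltn_ord.
Qed.

Lemma hlength_le (u : seq 'I_n) : (hlength (hword u) <= size u)%N.
Proof.
rewrite /hlength; case: ex_minnP => k _; apply.
by apply/asboolP; exists u.
Qed.

(** The word [cword (hcode x)] gives one inequality. For the other, each letter of a word raises the
    sum of the code by at most one ([sumn_act]). *)
Lemma hlengthE x : hlength x = sumn (hcode x).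
Proof.
apply/eqP; rewrite eqn_leq; apply/andP; split.
  rewrite -{1}(hcodeK x) (leq_trans (hlength_le _)) //.
  by rewrite (leq_trans _ (size_cword _)) // size_pmap count_size.
rewrite /hlength; case: ex_minnP => k /asboolP[u <- <-] _; rewrite hcode_word.
elim/last_ind: u => [|u i IH]; first by rewrite sumn_nseq.
rewrite map_rcons foldl_rcons size_rcons.
have [->|->] := sumn_act (foldl act (nseq n 0%N) (map val u)) i => //.
exact: leqW.
Qed.

Lemma hmul_gen x (i : 'I_n) :
  x ** hword [:: i] = x \/ hlength (x ** hword [:: i]) = (hlength x).+1.
Proof.
rewrite !hlengthE hcode_gen; have [E|->] := sumn_act (hcode x) i; last by right.
by left; rewrite -[LHS]hcodeK hcode_gen E hcodeK.
Qed.

Lemma hlength_mulr x y : (hlength x <= hlength (x ** y))%N.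
Proof.
rewrite -(hword_repr y); elim/last_ind: (repr y) => [|u i IH].
  by rewrite hmulr1.
rewrite -cats1 -hmulE hmulA (leq_trans IH) //.
by have [->|->] := hmul_gen (x ** hword u) i.
Qed.

(** Absorption gives v u = u for every v in the submonoid, so no v is longer than u. As [xget] may
    return any longest element, uniqueness has to be shown as well. *)
Lemma longest_eq (J : {set 'I_n}) (u : seq 'I_n) : {subset u <= J} ->
  (forall i, i \in J -> hword (i :: u) = hword u) -> longest J = hword u.
Proof.
move=> uJ uabs.
have mulu v : {subset v <= J} -> hword v ** hword u = hword u.
  elim: v => [|i v IH] vJ; first by rewrite hmul1.
  rewrite -cat1s -hmulE -hmulA IH ?hmulE ?uabs ?vJ ?mem_head // => j jv.
  by rewrite vJ // in_cons jv orbT.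
have lu : longest_in J (hword u).
  split=> [|_ [v vJ ->]]; first by exists u.
  by rewrite -(mulu _ vJ) hlength_mulr.
rewrite /longest; case: xgetP => [w _ [[v vJ ->] vmax]|/(_ (hword u)) //].
(* A longest element v is fixed by the generators of J, so v = v u = u. *)
have vfix i : i \in J -> hword v ** hword [:: i] = hword v.
  move=> iJ; have [//|ll] := hmul_gen (hword v) i.
  have /vmax : in_submonoid J (hword v ** hword [:: i]).
    exists (rcons v i); last by rewrite hmulE cats1.
    by move=> j; rewrite mem_rcons => /predU1P[->|/vJ].
  by rewrite ll ltnn.
rewrite -[RHS](mulu _ vJ); elim/last_ind: u uJ {uabs mulu lu} => [|u i IH] uJ.
  by rewrite hmulr1.
rewrite -cats1 -hmulE hmulA -IH ?vfix ?uJ ?mem_rcons ?mem_head // => j ju.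
by rewrite uJ // mem_rcons in_cons ju orbT.
Qed.

End Hecke.

(** * Longest elements *)

(* For increasing [s], a (non-reduced) word for the longest element of the    *)
(* parabolic submonoid on [s].                                                *)
Definition top_word (T : Type) (s : seq T) : seq T :=
  foldl (fun u i => u ++ i :: u) [::] s.

Lemma top_word_rcons T (s : seq T) i :
  top_word (rcons s i) = top_word s ++ i :: top_word s.
Proof. by rewrite /top_word -cats1 foldl_cat. Qed.

Lemma map_top_word T U (f : T -> U) s :
  map f (top_word s) = top_word (map f s).
Proof.
elim/last_ind: s => // s i IH.
by rewrite map_rcons !top_word_rcons map_cat /= IH.
Qed.

Lemma top_word_sub (T : eqType) (s : seq T) : {subset top_word s <= s}.
Proof.
elim/last_ind: s => // s i IH j; rewrite top_word_rcons mem_rcons.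
by rewrite mem_cat !in_cons => /or3P[/IH ->|->|/IH ->]; rewrite ?orbT.
Qed.

Section TopProduct.
Variables (n : nat) (A : nzRingType) (f : 'I_n -> A).
Hypothesis hf : hecke_family f.

Let W (s : seq 'I_n) : A := \prod_(i <- top_word s) f i.

Let W_rcons s i : W (rcons s i) = W s * f i * W s.
Proof. by rewrite /W top_word_rcons big_cat big_cons /= mulrA. Qed.

Lemma comm_top_word (s : seq 'I_n) (i : 'I_n) :
    {in s, forall j : 'I_n, (i.+1 < j)%N || (j.+1 < i)%N} ->
  f i * W s = W s * f i.
Proof.
move=> si; have {si} :
    {in top_word s, forall j : 'I_n, (i.+1 < j)%N || (j.+1 < i)%N}.
  by move=> j /top_word_sub /si.
rewrite /W; elim: (top_word s) => [|j u IH] ju.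
  by rewrite big_nil mulr1 mul1r.
rewrite big_cons mulrA (hecke_family_comm hf) ?ju ?mem_head //.
by rewrite -!mulrA IH // => k ku; rewrite ju // in_cons ku orbT.
Qed.

Let W_idem u : {in u, forall i, f i * W u = W u} -> W u * W u = W u.
Proof.
move=> uW; have : {subset top_word u <= u} by exact: top_word_sub.
rewrite {1}/W; elim: (top_word u) => [|i v IH] vu.
  by rewrite big_nil mul1r.
rewrite big_cons -mulrA IH ?uW ?vu ?mem_head // => j jv.
by rewrite vu // in_cons jv orbT.
Qed.

(** In W c W, with c the largest letter, W absorbs the smaller letters by induction. For c itself,
    either c commutes with W, or the letter b before it is c - 1 and the braid relation is
    needed. *)
Lemma top_word_absorb (s : seq 'I_n) :
  pairwise (fun i j : 'I_n => i < j)%N s ->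
  {in s, forall i, f i * \prod_(j <- top_word s) f j =
                   \prod_(j <- top_word s) f j}.
Proof.
have [m] := ubnP (size s); elim: m s => // m IHm s; case/lastP: s => // s c.
rewrite size_rcons ltnS => sm; have IH := IHm _ sm.
rewrite pairwise_rcons => /andP[/allP sc ss] i.
rewrite -!/(W _) mem_rcons W_rcons => /predU1P[->|/(IH ss)]; last first.
  by rewrite -/(W s) => iW; rewrite !mulrA iW.
case/lastP: s => [|s b] in sm sc ss IH *.
  by rewrite /W big_nil mulr1 mul1r (hecke_family_idem hf).
have bc : (b < c)%N by apply: sc; rewrite mem_rcons mem_head.
have [sb ss'] : {in s, forall j : 'I_n, (j < b)%N} /\
    pairwise (fun i j : 'I_n => i < j)%N s.
  by move: ss; rewrite pairwise_rcons => /andP[/allP].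
have [bc1|bc1] := eqVneq b.+1 (c : nat); last first.
  have cW : f c * W (rcons s b) = W (rcons s b) * f c.
    apply: comm_top_word => j; rewrite mem_rcons => /predU1P[->|/sb jb].
      by rewrite orbC (ltn_neqAle b.+1) bc1 bc.
    by rewrite orbC (leq_trans _ bc).
  by rewrite !mulrA cW -(mulrA (W _) (f c)) (hecke_family_idem hf).
(* c = b + 1: with V = W s, both sides reduce to V b c V b V.                 *)
have {sc IH ss} abs := IH ss.
have cV x : f c * (W s * x) = W s * (f c * x).
  rewrite !mulrA comm_top_word // => j /sb jb.
  by rewrite orbC (leq_trans _ bc).
have VV x : W s * (W s * x) = W s * x.
  (* This [s] is two letters shorter than the list under consideration, which is why the induction
     is strong. *)
  rewrite mulrA W_idem //; apply: IHm => //.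
  by rewrite (leq_trans _ sm) // size_rcons.
have key x : W s * (f c * (W s * x)) = f c * (W s * x) by rewrite -cV VV.
have br x : f c * (f b * (f c * x)) = f b * (f c * (f b * x)).
  by rewrite !mulrA (hecke_family_braid hf (esym bc1)).
have bVb : f b * (W s * (f b * W s)) = W s * (f b * W s).
  by have := abs b; rewrite mem_rcons mem_head -/(W _) W_rcons -!mulrA; apply.
by rewrite W_rcons -!mulrA key cV br bVb.
Qed.

Lemma top_word_idem (s : seq 'I_n) : pairwise (fun i j : 'I_n => i < j)%N s ->
  (\prod_(i <- top_word s) f i) * (\prod_(i <- top_word s) f i) =
  \prod_(i <- top_word s) f i.
Proof. by move=> ss; apply: W_idem; exact: top_word_absorb. Qed.

End TopProduct.

Lemma pairwise_enum_ord n (J : {set 'I_n}) :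
  pairwise (fun i j : 'I_n => i < j)%N (enum J).
Proof.
have : pairwise ltn (map val (enum 'I_n)).
  rewrite val_enum_ord -sorted_pairwise ?iota_ltn_sorted //.
  exact: ltn_trans.
rewrite pairwise_map; apply: subseq_pairwise.
by rewrite [enum J]/enum_mem -enumT; exact: filter_subseq.
Qed.

Lemma wid_inj n : injective (widen_ord (leqnSn n)).
Proof. by move=> i j [] /val_inj. Qed.

Lemma wid_neq_max n (i : 'I_n) : wid i != ord_max.
Proof. by rewrite -val_eqE /= ltn_eqF. Qed.

Lemma ord_max_wid n (J : {set 'I_n}) : ord_max \in wid @: J = false.
Proof.
by apply/imsetP => -[i _ /eqP]; rewrite eq_sym (negPf (wid_neq_max i)).
Qed.

Lemma enum_wid n (J : {set 'I_n}) : enum (wid @: J) = map wid (enum J).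
Proof.
rewrite /enum_mem -!enumT enum_ordSr filter_rcons /= ord_max_wid filter_map.
by congr map; apply: eq_filter => i /=; rewrite mem_imset //; exact: wid_inj.
Qed.

Lemma enum_wid_max n (J : {set 'I_n}) :
  enum (ord_max |: wid @: J) = rcons (enum (wid @: J)) ord_max.
Proof.
rewrite enum_wid /enum_mem -!enumT enum_ordSr filter_rcons /= setU11 filter_map.
congr (rcons (map _ _) _); apply: eq_filter => i /=.
by rewrite in_setU1 (negPf (wid_neq_max i)) mem_imset //; exact: wid_inj.
Qed.

(** * Longest elements of either sign in the algebra *)

Section SignedTop.
Variables (R : realType).

Definition signed_pi n (s : bool) : 'I_n -> hecke_alg R n :=
  if s then @hpi R n else @hpibar R n.

Lemma hecke_family_signed_pi n s : hecke_family (@signed_pi n s).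
Proof. by case: s; [exact: hecke_family_pi|exact: hecke_family_pibar]. Qed.

(** [top_word_absorb] is an identity in a ring. It is applied in the algebra and carried back to the
    monoid by comparing coefficients, since distinct monoid elements are distinct basis vectors. *)
Lemma longestE n (J : {set 'I_n}) : longest J = hword (top_word (enum J)).
Proof.
apply: longest_eq => [i /top_word_sub|i iJ]; first by rewrite mem_enum.
have : << hword (i :: top_word (enum J)) >> =
       << hword (top_word (enum J)) >> :> hecke_alg R n.
  transitivity (\prod_(j <- i :: top_word (enum J)) hpi R j).
    exact/esym/hpi_prod.
  transitivity (\prod_(j <- top_word (enum J)) hpi R j); last exact: hpi_prod.
  rewrite big_cons.
  apply: top_word_absorb; last by rewrite mem_enum.
    exact: hecke_family_pi.
  exact: pairwise_enum_ord.
move=> /(congr1 (fun x : {malg R[i][hecke n]} =>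
  x@_(hword (i :: top_word (enum J))))).
by rewrite !mcoeffU eqxx; case: eqP => [-> //|_ /eqP]; rewrite oner_eq0.
Qed.

Lemma w_signedE n s (J : {set 'I_n}) :
  w_signed R s J = \prod_(i <- top_word (enum J)) signed_pi s i.
Proof.
rewrite /w_signed longestE -(hpi_prod R (top_word _)); case: s => //.
by rewrite rmorph_prod; apply: eq_bigr => i _; exact: Psi_pi.
Qed.

Lemma w_signed_idem n s (J : {set 'I_n}) :
  w_signed R s J * w_signed R s J = w_signed R s J.
Proof.
rewrite w_signedE; apply: top_word_idem; last exact: pairwise_enum_ord.
exact: hecke_family_signed_pi.
Qed.

Lemma hincl_signed_pi n s (i : 'I_n) :
  hincl (signed_pi s i) = signed_pi s (wid i).
Proof.
case: s; rewrite /signed_pi; first exact: hincl_pi.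
by rewrite /hpibar rmorphB rmorph1; congr (1 - _); exact: hincl_pi.
Qed.

Lemma w_signed_wid n s (J : {set 'I_n}) :
  w_signed R s (wid @: J) = hincl (w_signed R s J).
Proof.
rewrite !w_signedE enum_wid -map_top_word big_map rmorph_prod.
by apply: eq_bigr => i _; exact/esym/hincl_signed_pi.
Qed.

(** The new node is the largest, so it comes last in the enumeration and one step of the recursion
    of [top_word] applies. *)
Lemma w_signed_max n s (J : {set 'I_n}) :
  w_signed R s (ord_max |: wid @: J) =
  hincl (w_signed R s J) * signed_pi s ord_max * hincl (w_signed R s J).
Proof.
rewrite -w_signed_wid !w_signedE enum_wid_max enum_wid top_word_rcons.
by rewrite big_cat big_cons /= mulrA.
Qed.

End SignedTop.

(** * Blocks of a signed diagram *)

Section Runs.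
Variables (n : nat) (D : n.-tuple bool).
Implicit Types (i j k : 'I_n) (J K : {set 'I_n}).

(** An equivalence relation on nodes whose classes are the blocks ([is_blockP]); it replaces
    maximality among sets by a condition on two nodes. *)
Definition conn i j : bool :=
  [forall k : 'I_n, (minn i j <= k <= maxn i j)%N ==> (tnth D k == tnth D i)].

Lemma connP i j : reflect
  (forall k, (minn i j <= k <= maxn i j)%N -> tnth D k = tnth D i) (conn i j).
Proof.
apply: (iffP forallP) => [ij k kij|ij k]; last by apply/implyP => /ij ->.
by apply/eqP/(implyP (ij k)).
Qed.

Lemma conn_refl i : conn i i.
Proof. by apply/connP => k ki; congr tnth; apply: ord_inj; lia. Qed.

Lemma conn_sign i j : conn i j -> tnth D j = tnth D i.
Proof. by move/connP; apply; rewrite geq_minr leq_maxr. Qed.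

Lemma conn_sym i j : conn i j = conn j i.
Proof.
suff sym i' j' : conn i' j' -> conn j' i' by apply/idP/idP; exact: sym.
move=> ij; have ji := conn_sign ij; move/connP: ij => ij.
by apply/connP => k; rewrite minnC maxnC ji; exact: ij.
Qed.

Lemma conn_trans i j k : conn i j -> conn j k -> conn i k.
Proof.
move=> ij; have ji := conn_sign ij; move/connP: ij => ij /connP jk.
apply/connP => l lik; have [lij|lij] := boolP (minn i j <= l <= maxn i j)%N.
  exact: ij.
rewrite -ji jk //; lia.
Qed.

Definition run i : {set 'I_n} := [set j | conn i j].

Lemma mem_run i j : (j \in run i) = conn i j.
Proof. by rewrite inE. Qed.

Lemma run_eq i j : (run i == run j) = conn i j.
Proof.
apply/eqP/idP => [ij|ij]; first by rewrite -mem_run ij mem_run conn_refl.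
apply/setP => k; rewrite !mem_run; apply/idP/idP; last exact: conn_trans.
by apply: conn_trans; rewrite conn_sym.
Qed.

Lemma sub_run J i :
  Defs.interval J -> same_sign D J -> i \in J -> J \subset run i.
Proof.
move=> /forall_inP Jint /forall_inP Jsgn iJ; apply/fintype.subsetP => j jJ.
rewrite mem_run; apply/connP => k kij.
have kJ : k \in J.
  have [ij|/ltnW ji] := leqP i j.
    move/forall_inP/(_ _ jJ)/forallP/(_ k)/implyP: (Jint _ iJ); apply; lia.
  move/forall_inP/(_ _ iJ)/forallP/(_ k)/implyP: (Jint _ jJ); apply; lia.
by apply/esym/eqP; move/forall_inP: (Jsgn _ iJ); exact.
Qed.

(** A run is itself an interval of constant sign, and it contains every such interval through its
    base node ([sub_run]). *)
Lemma is_blockP J : reflect (exists i, J = run i) (is_block D J).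
Proof.
have runP i :
    [&& run i != finset.set0, Defs.interval (run i) & same_sign D (run i)].
  apply/and3P; split.
  - by apply/set0Pn; exists i; rewrite mem_run conn_refl.
  - apply/forall_inP => j; rewrite mem_run => /connP ij.
    apply/forall_inP => l; rewrite mem_run => /connP il.
    apply/forallP => k; apply/implyP => kjl; rewrite mem_run; apply/connP => p.
    move=> pik; have [pij|pij] := boolP (minn i j <= p <= maxn i j)%N.
      exact: ij.
    apply: il; lia.
  - apply/forall_inP => j; rewrite mem_run => /conn_sign ->.
    by apply/forall_inP => l; rewrite mem_run => /conn_sign ->.
apply: (iffP idP) => [/maxsetP[/and3P[/set0Pn[i iJ] Jint Jsgn] Jmax]|[i ->]].
  by exists i; rewrite (Jmax (run i)) // sub_run.
apply/maxsetP; split=> // K /and3P[_ Kint Ksgn] iK.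
apply/eqP; rewrite finset.eqEsubset iK sub_run //.
by apply: (fintype.subsetP iK); rewrite mem_run conn_refl.
Qed.

Lemma starts_beforeP J K : reflect
  (exists2 i, i \in J & {in K, forall j, (i <= j)%N}) (starts_before J K).
Proof.
apply: (iffP exists_inP) => -[i iJ iK]; exists i => //; last exact/forall_inP.
exact/forall_inP.
Qed.

Lemma starts_before_trans : transitive (@starts_before n).
Proof.
move=> K J L /starts_beforeP[i iJ iK] /starts_beforeP[k kK kL].
by apply/starts_beforeP; exists i => // j /kL; apply: leq_trans; exact: iK.
Qed.

Lemma starts_before_total J K : J != finset.set0 -> K != finset.set0 ->
  starts_before J K || starts_before K J.
Proof.
move=> /set0Pn[i0 i0J] /set0Pn[k0 k0K].
case: (arg_minnP (fun i : 'I_n => i : nat) i0J) => i iJ imin.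
case: (arg_minnP (fun i : 'I_n => i : nat) k0K) => k kK kmin.
case: (leqP i k) => ik; apply/orP; [left|right]; apply/starts_beforeP.
  by exists i => // j /kmin; exact: leq_trans.
by exists k => // j /imin; apply: leq_trans; exact: ltnW.
Qed.

Lemma block_neq0 J : is_block D J -> J != finset.set0.
Proof.
by case/is_blockP => i ->; apply/set0Pn; exists i; rewrite mem_run conn_refl.
Qed.

Let total_blocks : {in is_block D &, total (@starts_before n)}.
Proof.
by move=> J K /block_neq0 J0 /block_neq0; exact: starts_before_total.
Qed.

Lemma mem_blocks J : (J \in blocks D) = is_block D J.
Proof. by rewrite mem_sort mem_enum. Qed.

Lemma blocks_uniq : uniq (blocks D).
Proof. by rewrite sort_uniq enum_uniq. Qed.

Lemma blocks_pairwise : pairwise (@starts_before n) (blocks D).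
Proof.
rewrite -sorted_pairwise; last exact: starts_before_trans.
rewrite /blocks; apply: (sort_sorted_in total_blocks).
by apply/allP => J; rewrite mem_enum.
Qed.

(** On blocks [starts_before] is antisymmetric: two blocks with the same least node meet, hence
    coincide. So there is only one sorted list of the blocks. *)
Lemma blocks_eq (B : seq {set 'I_n}) : uniq B -> B =i is_block D ->
  pairwise (@starts_before n) B -> blocks D = B.
Proof.
move=> Bu Bb Bs; apply: (sorted_eq_in (leT := @starts_before n)).
- by move=> J K L _ _ _; exact: starts_before_trans.
- move=> J K; rewrite !mem_blocks => /is_blockP[i ->] /is_blockP[j ->].
  case/andP=> /starts_beforeP[k ki kj] /starts_beforeP[l lj li].
  apply/eqP; rewrite run_eq; have kl : k = l.
    by apply: ord_inj; apply/eqP; rewrite eqn_leq kj // li.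
  by move: ki lj; rewrite !mem_run kl (conn_sym j) => /conn_trans; apply.
- rewrite sorted_pairwise ?blocks_pairwise //; exact: starts_before_trans.
- rewrite sorted_pairwise //; exact: starts_before_trans.
- by rewrite uniq_perm ?blocks_uniq // => J; rewrite mem_blocks Bb.
Qed.

(* [ilast] says that the block of [i] is the last one. *)
Section LastRun.
Variable i : 'I_n.
Hypothesis ilast : forall j, (i <= j)%N -> conn i j.

(** If the run of i starts before the block of k, then k lies either beyond i or between two nodes
    of that run; in both cases the two blocks are equal. *)
Lemma starts_before_last J : is_block D J -> starts_before J (run i).
Proof.
move=> Jb; have irun : is_block D (run i) by apply/is_blockP; exists i.
have /orP[//|] := total_blocks Jb irun.
case/is_blockP: Jb => k -> /starts_beforeP[j ij jk].
have {jk} jk : (j <= k)%N by apply: jk; rewrite mem_run conn_refl.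
suff /eqP <- : run i == run k.
  by case/orP: (total_blocks irun irun).
rewrite run_eq; have [/ilast //|/ltnW ki] := leqP i k.
rewrite mem_run in ij; apply/connP => l lik; apply: (connP _ _ ij); lia.
Qed.

Lemma blocks_last : blocks D = rcons [seq J <- blocks D | J != run i] (run i).
Proof.
apply: blocks_eq => [|J|].
- by rewrite rcons_uniq filter_uniq ?blocks_uniq // mem_filter eqxx.
- rewrite mem_rcons in_cons mem_filter mem_blocks [RHS]/in_mem /=.
  by case: eqP => //= ->; apply/esym/is_blockP; exists i.
- rewrite pairwise_rcons pairwise_filter ?blocks_pairwise // andbT.
  apply/allP => J; rewrite mem_filter mem_blocks => /andP[_].
  exact: starts_before_last.
Qed.

End LastRun.

Lemma block_sign_run i : block_sign D (run i) = tnth D i.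
Proof.
apply/exists_inP/idP => [[j]|Di]; first by rewrite mem_run => /conn_sign ->.
by exists i => //; rewrite mem_run conn_refl.
Qed.

End Runs.

(** * Blocks after adjoining a node *)

Section Rcons.
Variables (n : nat) (D : n.-tuple bool) (s : bool).
Implicit Types (i j : 'I_n) (J : {set 'I_n}).

Let D' := rcons_tuple D s.

Lemma tnth_rcons_wid i : tnth D' (wid i) = tnth D i.
Proof. by rewrite !(tnth_nth false) /= nth_rcons size_tuple ltn_ord. Qed.

Lemma tnth_rcons_max : tnth D' ord_max = s.
Proof. by rewrite (tnth_nth false) /= nth_rcons size_tuple ltnn eqxx. Qed.

Lemma conn_wid i j : conn D' (wid i) (wid j) = conn D i j.
Proof.
apply/connP/connP => ij k kij.
  by rewrite -!tnth_rcons_wid; exact: ij.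
have kn : (k < n)%N.
  by case/andP: kij => _ /leq_ltn_trans; apply; rewrite gtn_max /= !ltn_ord.
have -> : k = wid (Ordinal kn) by apply: ord_inj.
by rewrite !tnth_rcons_wid; exact: ij.
Qed.

(* The last block of [D] if the new node has the same sign, else empty. *)
Definition last_part : {set 'I_n} := [set j | conn D' ord_max (wid j)].

Lemma run_max : run D' ord_max = ord_max |: wid @: last_part.
Proof.
apply/setP => k; rewrite mem_run in_setU1.
have [->|k_max] := eqVneq k ord_max; first by rewrite conn_refl.
have kn : (k < n)%N by rewrite ltn_neqAle -ltnS ltn_ord andbT.
have -> : k = wid (Ordinal kn) by apply: ord_inj.
by rewrite mem_imset ?inE //; exact: wid_inj.
Qed.

Lemma last_part_run i : i \in last_part ->
  last_part = run D i /\ (forall j, (i <= j)%N -> conn D i j).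
Proof.
rewrite inE => ci; split=> [|j ij].
  apply/setP => j; rewrite !inE -conn_wid.
  by apply/idP/idP; apply: conn_trans; rewrite // conn_sym.
rewrite -conn_wid; have /connP cm : conn D' (wid i) ord_max by rewrite conn_sym.
by apply/connP => k kij; apply: cm => /=; move: kij ij (ltn_ord j) => /=; lia.
Qed.

Lemma run_wid i : run D i != last_part -> run D' (wid i) = wid @: run D i.
Proof.
move=> iP; have cm : ~~ conn D' (wid i) ord_max.
  apply: contra iP; rewrite conn_sym => ci.
  by have [|-> //] := @last_part_run i; rewrite inE.
apply/setP => k; rewrite mem_run.
have [->|k_max] := eqVneq k ord_max; first by rewrite ord_max_wid (negPf cm).
have kn : (k < n)%N by rewrite ltn_neqAle -ltnS ltn_ord andbT.
have -> : k = wid (Ordinal kn) by apply: ord_inj.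
by rewrite mem_imset ?inE ?conn_wid //; exact: wid_inj.
Qed.

Lemma starts_before_wid J (K : {set 'I_n}) :
  starts_before (wid @: J) (wid @: K) = starts_before J K.
Proof.
apply/starts_beforeP/starts_beforeP => -[k].
  case/imsetP=> j jJ -> jK; exists j => // l lK.
  by apply: (jK (wid l)); exact: imset_f.
by move=> kJ kK; exists (wid k); rewrite ?imset_f // => _ /imsetP[j /kK ? ->].
Qed.

(** Only [last_part] merges with the new node; every other block survives. When [last_part] is empty
    the filter removes nothing, so a single formula covers both cases. *)
Lemma blocks_rcons : blocks D' =
  rcons (map (fun J => wid @: J) [seq J <- blocks D | J != last_part])
        (run D' ord_max).
Proof.
have Mlast (j : 'I_n.+1) : (@ord_max n <= j)%N -> conn D' ord_max j.
  move=> mj; suff -> : j = ord_max by exact: conn_refl.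
  by apply: ord_inj; apply/eqP; rewrite eqn_leq mj -ltnS ltn_ord.
have Mb J : J \in [seq J <- blocks D | J != last_part] ->
    is_block D' (wid @: J).
  rewrite mem_filter mem_blocks => /andP[JP /is_blockP[i Ji]].
  by apply/is_blockP; exists (wid i); rewrite run_wid -Ji.
apply: blocks_eq => [|K|].
- rewrite rcons_uniq map_inj_uniq ?filter_uniq ?blocks_uniq //; last first.
    exact/imset_inj/wid_inj.
  rewrite andbT; apply/mapP => -[J _] /setP/(_ ord_max).
  by rewrite mem_run conn_refl ord_max_wid.
- rewrite mem_rcons in_cons [RHS]/in_mem /=; apply/idP/is_blockP.
    case/predU1P=> [->|/mapP[J /Mb/is_blockP[i Ji] ->]].
      by exists ord_max.
    by exists i.
  move=> [k ->]; have [->|k_max] := eqVneq k ord_max; first by rewrite eqxx.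
  have kn : (k < n)%N by rewrite ltn_neqAle -ltnS ltn_ord andbT.
  have -> : k = wid (Ordinal kn) by apply: ord_inj.
  have [/eqP|kP] := eqVneq (run D (Ordinal kn)) last_part.
    move/eqP/setP/(_ (Ordinal kn)); rewrite mem_run conn_refl inE => /esym.
    by rewrite run_eq conn_sym => ->.
  rewrite run_wid // map_f ?orbT // mem_filter kP mem_blocks.
  by apply/is_blockP; exists (Ordinal kn).
- rewrite pairwise_rcons pairwise_map; apply/andP; split.
    by apply/allP => _ /mapP[J /Mb Jb ->]; exact: starts_before_last.
  apply: (sub_pairwise (r := @starts_before n)) => [J K|].
    by rewrite /= starts_before_wid.
  by rewrite pairwise_filter ?blocks_pairwise.
Qed.

Lemma blocks_last_part (T := [seq J <- blocks D | J != last_part]) :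
  last_part = finset.set0 /\ blocks D = T \/
  blocks D = rcons T last_part /\ block_sign D last_part = s.
Proof.
have [P0|[i iP]] := set_0Vmem last_part; [left|right]; split=> //.
- rewrite /T P0 (all_filterP _) //.
  by apply/allP => J; rewrite mem_blocks => /block_neq0.
- by have [PD ilast] := last_part_run iP; rewrite /T PD -blocks_last.
- have [-> _] := last_part_run iP; rewrite block_sign_run -tnth_rcons_wid.
  by rewrite -[RHS]tnth_rcons_max; move: iP; rewrite inE => /conn_sign.
Qed.

Lemma block_sign_wid J : block_sign D' (wid @: J) = block_sign D J.
Proof.
apply/exists_inP/exists_inP => -[k].
  by case/imsetP=> j jJ ->; rewrite tnth_rcons_wid; exists j.
by move=> kJ Dk; exists (wid k); rewrite ?imset_f ?tnth_rcons_wid.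
Qed.

End Rcons.

(** * The recursion for diagram demipotents *)

Lemma sandwich (A : nzRingType) (w p g x y : A) :
  w = p * g * p -> w * w = w -> x * w * (w * y) = x * p * g * (p * y).
Proof. by move=> wE ww; rewrite mulrA -(mulrA x) ww wE !mulrA. Qed.

Section Diagrams.
Variables (R : realType) (n : nat) (D : n.-tuple bool) (s : bool).

Local Notation w J := (w_signed R (block_sign D J) J).
Let P := last_part D s.
Let T := [seq J <- blocks D | J != P].

Lemma L_diag_last : L_diag R D = (\prod_(J <- T) w J) * w_signed R s P.
Proof.
rewrite /L_diag; have [[P0 ->]|[-> Ps]] := blocks_last_part D s.
  have -> : w_signed R s P = 1 by rewrite /P P0 w_signedE enum_set0 big_nil.
  by rewrite mulr1.
by rewrite -cats1 big_cat big_seq1 /= Ps.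
Qed.

Lemma R_diag_last : R_diag R D = w_signed R s P * \prod_(J <- rev T) w J.
Proof.
rewrite /R_diag; have [[P0 ->]|[-> Ps]] := blocks_last_part D s.
  have -> : w_signed R s P = 1 by rewrite /P P0 w_signedE enum_set0 big_nil.
  by rewrite mul1r.
by rewrite rev_rcons big_cons Ps.
Qed.

Let wP := w_signed R s (run (rcons_tuple D s) ord_max).

Let hincl_w (J : {set 'I_n}) :
  w_signed R (block_sign (rcons_tuple D s) (wid @: J)) (wid @: J) =
  hincl (w J).
Proof. by rewrite block_sign_wid w_signed_wid. Qed.

Lemma L_diag_rcons :
  L_diag R (rcons_tuple D s) = hincl (\prod_(J <- T) w J) * wP.
Proof.
rewrite /L_diag blocks_rcons -cats1 big_cat big_seq1 /=.
rewrite block_sign_run tnth_rcons_max big_map rmorph_prod; congr (_ * _).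
by apply: eq_bigr => J _; exact: hincl_w.
Qed.

Lemma R_diag_rcons :
  R_diag R (rcons_tuple D s) = wP * hincl (\prod_(J <- rev T) w J).
Proof.
rewrite /R_diag blocks_rcons rev_rcons big_cons.
rewrite block_sign_run tnth_rcons_max -map_rev big_map rmorph_prod.
by congr (_ * _); apply: eq_bigr => J _; exact: hincl_w.
Qed.

Lemma hinclM (x y : hecke_alg R n) : hincl (x * y) = hincl x * hincl y.
Proof. exact: rmorphM. Qed.

Lemma hincl_L_diag : hincl (L_diag R D) =
  hincl (\prod_(J <- T) w J) * hincl (w_signed R s P).
Proof. rewrite L_diag_last; exact: hinclM. Qed.

Lemma hincl_R_diag : hincl (R_diag R D) =
  hincl (w_signed R s P) * hincl (\prod_(J <- rev T) w J).
Proof. rewrite R_diag_last; exact: hinclM. Qed.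

Lemma C_diag_rcons : C_diag R (rcons_tuple D s) =
  hincl (L_diag R D) * signed_pi R s ord_max * hincl (R_diag R D).
Proof.
rewrite /C_diag L_diag_rcons R_diag_rcons hincl_L_diag hincl_R_diag.
(* Here w is the longest element of the new last block, p that of [last_part], g the new signed
   generator, and x and y are the products over the remaining blocks. *)
apply: sandwich.
  by rewrite /wP run_max w_signed_max.
exact: w_signed_idem.
Qed.

End Diagrams.

Lemma C_diag_sum_rcons (R : realType) n (D : n.-tuple bool) :
  C_diag R (rcons_tuple D true) + C_diag R (rcons_tuple D false) =
  hincl (C_diag R D).
Proof.
rewrite !C_diag_rcons -mulrDl -mulrDr /= /hpibar addrC subrK mulr1.
by rewrite [RHS]rmorphM.
Qed.

Lemma rcons_tuple_bij (T : finType) n :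
  bijective (fun u : n.-tuple T * T => rcons_tuple u.1 u.2).
Proof.
apply: inj_card_bij => [[t x] [u y]|].
  by move=> /(congr1 val)/rcons_inj[/val_inj -> ->].
by rewrite card_prod !card_tuple expnSr.
Qed.

(** Grouping the diagrams by all signs but the last reduces the sum to the image under [hincl] of
    the sum for one node fewer. *)
Lemma sum_C_diag (R : realType) n :
  \sum_(D : n.-tuple bool) C_diag R D = 1 :> hecke_alg R n.
Proof.
elim: n => [|n IH].
  rewrite (big_pred1 [tuple]) => [|D]; last by apply/esym/eqP; exact: tuple0.
  (* The empty diagram has no block, because a block is the run of some node. *)
  rewrite /C_diag /L_diag /R_diag; case B: (blocks _) => [|J u].
    by rewrite !big_nil mulr1.
  have : J \in blocks [tuple] by rewrite B mem_head.
  by rewrite mem_blocks => /is_blockP[[]].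
rewrite (reindex _ (onW_bij _ (rcons_tuple_bij _ _))) /=.
rewrite -(pair_bigA _ (fun D s => C_diag R (rcons_tuple D s))) /=.
transitivity (\sum_(D : n.-tuple bool) hincl (C_diag R D)).
  by apply: eq_bigr => D _; rewrite big_bool; exact: C_diag_sum_rcons.
by rewrite -rmorph_sum IH rmorph1.
Qed.

(* N = n + 1; the generator pi_N of C H_0(S_(N+1)) is hpi R ord_max. *)
Theorem corollary4p2 (R : realType) (n : nat) :
  (forall D : n.-tuple bool,
    [/\ C_diag R (rcons_tuple D true) =
          hincl (L_diag R D) * hpi R ord_max * hincl (R_diag R D),
        C_diag R (rcons_tuple D false) =
          hincl (L_diag R D) * hpibar R ord_max * hincl (R_diag R D) &
        C_diag R (rcons_tuple D true) + C_diag R (rcons_tuple D false) =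
          hincl (C_diag R D)]) /\
  \sum_(D : n.-tuple bool) C_diag R D = 1.
Proof.
split=> [D|]; last exact: sum_C_diag.
by split; [exact: C_diag_rcons|exact: C_diag_rcons|exact: C_diag_sum_rcons].
Qed.
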